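(* Fix real numbers $a>b>0$ and an integer $k\ge2$. Let $p=p(n)=\omega\,a/n$ and $q=q(n)=\omega\,b/n$. For any $\varepsilon>0$ there exists $c=c(\varepsilon)$ such that, if $\omega>c$, then the following holds with probability at least $1-\varepsilon$ provided $n$ is large enough. Let $G\in\mathcal{G}(n,k,p,q)$ with planted partition $\mathcal{P}$. For any $d\in\left[0,\frac1k\right]$, let $$H(d)=\max_{\mathcal{A}:\,|\mathcal{A}|\le k}\left\{q_{\mathcal{A}}(G)\ :\ d-\frac{1}{\sqrt n}\le d(\mathcal{A},\mathcal{P})\le d+\frac{1}{\sqrt n}\right\}.$$ Then $$\left|H(d)-\frac{a-b}{a+(k-1)b}\cdot h(d)\right|\le\varepsilon,\qquad\text{where}\quad h(d)=1-\frac1k-2d\big(1-d(k-1)\big).$$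
   Context: Modularity: for a graph $G=(V,E)$ with $m=|E|\ge1$ edges and a partition $\mathcal{A}$ of $V$, $q_{\mathcal{A}}(G)=\sum_{A\in\mathcal{A}}\frac{e(A)}{m}-\sum_{A\in\mathcal{A}}\left(\frac{\mathrm{vol}(A)}{\mathrm{vol}(V)}\right)^2$, where $e(A)$ is the number of edges inside $A$ and $\mathrm{vol}(A)=\sum_{v\in A}d_v$ is the sum of degrees. Stochastic block model $\mathcal{G}(n,k,p,q)$: the vertex set $[n]$ is partitioned into $k$ communities $P_1,\dots,P_k$ with $\lfloor n/k\rfloor\le|P_i|\le\lceil n/k\rceil$ (the planted partition $\mathcal{P}=(P_i)_{i=1}^k$); independently for each pair of vertices, an edge is present with probability $p$ if both are in the same community and with probability $q$ otherwise. Here $k$ is fixed, $n\to\infty$, and $\omega=\omega(n)$ may depend on $n$. Distance: for a $k$-part partition $\mathcal{A}=(A_i)_{i=1}^k$ of $[n]$, $d(\mathcal{A},\mathcal{P})=1-\frac1n\max_\sigma\sum_{i=1}^k|A_{\sigma(i)}\cap P_i|$, the maximum being over all permutations $\sigma$ of $[k]$. A partition with $|\mathcal{A}|\le k$ parts is regarded as a $k$-part partition by adding empty parts. *)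

(* Defs.v *)
From HB Require Import structures.
From mathcomp Require Import boolp classical_sets reals.
From mathcomp Require Import all_boot all_order all_algebra all_fingroup.

Set Implicit Arguments.
Unset Strict Implicit.
Unset Printing Implicit Defensive.

Import Order.TTheory GRing.Theory Num.Theory.
Local Open Scope ring_scope.

(* A simple graph on [V] is its edge set: a set of two-element subsets of [V]. *)
Definition vpairs (V : finType) : {set {set V}} :=
  [set e : {set V} | #|e| == 2%N].

Definition simple_graph (V : finType) (E : {set {set V}}) : bool :=
  E \subset vpairs V.

Definition degree (V : finType) (E : {set {set V}}) (v : V) : nat :=
  #|[set e in E | v \in e]|.

Definition vol (V : finType) (E : {set {set V}}) (A : {set V}) : nat :=
  (\sum_(v in A) degree E v)%N.

Definition edges_in (V : finType) (E : {set {set V}}) (A : {set V}) : nat :=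
  #|[set e in E | e \subset A]|.

(* Meaningful for [E != set0]; division by zero makes it 0 on the edgeless
   graph. *)
Definition modularity (R : realType) (V : finType) (E : {set {set V}})
    (AA : {set {set V}}) : R :=
  \sum_(A in AA) (edges_in E A)%:R / #|E|%:R
  - \sum_(A in AA) ((vol E A)%:R / (vol E [set: V])%:R) ^+ 2.

(* Indexed partitions; unlike in [partition], parts may be empty. *)
Definition kpart_partition (V : finType) (k : nat) (A : 'I_k -> {set V}) : Prop :=
  forall v : V, exists! i : 'I_k, v \in A i.

(* [(m + k.-1) %/ k] is the ceiling of m / k. *)
Definition balanced (V : finType) (k : nat) (P : 'I_k -> {set V}) : Prop :=
  forall i : 'I_k, (#|V| %/ k <= #|P i| <= (#|V| + k.-1) %/ k)%N.

(* When [#|AA| <= k], the parts of [AA] followed by empty parts. The order of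
   the enumeration is irrelevant to [kdist], which maximises over
   permutations. *)
Definition padded (V : finType) (k : nat) (AA : {set {set V}}) : 'I_k -> {set V} :=
  fun i => nth set0 (enum AA) i.

Definition kdist (R : realType) (V : finType) (k : nat)
    (A P : 'I_k -> {set V}) : R :=
  1 - #|V|%:R^-1 *
      (\max_(s : 'S_k) \sum_(i < k) #|A (s i) :&: P i|)%N%:R.

(* The random graph: each pair [e] is an edge independently, with probability
   [edge_prob p q P e]. [sbm_weight p q P E] is the probability of obtaining
   exactly the graph [E]. *)
Definition edge_prob (R : realType) (V : finType) (k : nat) (p q : R)
    (P : 'I_k -> {set V}) (e : {set V}) : R :=
  if [exists i, e \subset P i] then p else q.

Definition sbm_weight (R : realType) (V : finType) (k : nat) (p q : R)
    (P : 'I_k -> {set V}) (E : {set {set V}}) : R :=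
  \prod_(e in vpairs V)
    (if e \in E then edge_prob p q P e else 1 - edge_prob p q P e).

Definition sbm_prob (R : realType) (V : finType) (k : nat) (p q : R)
    (P : 'I_k -> {set V}) (event : {set {set V}} -> Prop) : R :=
  \sum_(E : {set {set V}} | simple_graph E && `[< event E >]) sbm_weight p q P E.

Lemma sbm_prob_total (R : realType) (V : finType) (k : nat) (p q : R)
    (P : 'I_k -> {set V}) : sbm_prob p q P (fun=> True) = 1.
Proof.
pose f e := if e \in vpairs V then edge_prob p q P e else 0.
pose g e := if e \in vpairs V then 1 - edge_prob p q P e else 1.
have -> : 1 = \prod_(e : {set V}) (f e + g e).
  by rewrite big1 // => e _; rewrite /f /g; case: ifP; rewrite ?add0r // addrC subrK.
rewrite bigA_distr /sbm_prob [RHS](bigID (fun E => simple_graph E)) /=.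
rewrite [X in _ = _ + X]big1 ?addr0; last first.
  move=> E /subsetPn[e eE eN]; rewrite (bigD1 e) //= eE /f (negbTE eN).
  by rewrite mul0r.
apply: eq_big => [E|E /andP[sE _]]; first by rewrite asboolT ?andbT.
rewrite /sbm_weight big_mkcond; apply: eq_bigr => e _.
rewrite /f /g; case: ifP => // eN; case: ifP => // eE.
by rewrite (subsetP sE e eE) in eN.
Qed.

Definition is_max (R : realType) (S : set R) (x : R) : Prop :=
  S x /\ ubound S x.

(* The values over which H(d) is the maximum. *)
Definition modularities_near (R : realType) (V : finType) (k : nat)
    (E : {set {set V}}) (P : 'I_k -> {set V}) (d : R) : set R :=
  fun x => exists AA : {set {set V}},
    [/\ partition AA [set: V], (#|AA| <= k)%N,
        d - (Num.sqrt #|V|%:R)^-1 <= kdist R (padded AA) P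
          <= d + (Num.sqrt #|V|%:R)^-1
      & x = modularity R E AA].

Definition hfun (R : realType) (k : nat) (d : R) : R :=
  1 - k%:R^-1 - 2 * d * (1 - d * (k%:R - 1)).

(* Main.v *)
Require Import Defs.
From HB Require Import structures.
From mathcomp Require Import boolp classical_sets reals.
From mathcomp Require Import sequences exp.
From mathcomp Require Import all_boot all_order all_algebra all_fingroup.
From mathcomp Require Import ring lra zify.

(** Write [w] for [omega n], where [n] is the number of vertices, and
    [x i j] for the fraction of the vertices that are both in part [i] of a
    partition and in the planted part [j].

    Randomness is removed first. The number of edges inside a set of vertices is
    a sum of independent indicators of mean at most of order [w * n], so
    Chernoff's bound makes a deviation of order [w * n] exponentially unlikely
    in [w * n]. For a large constant [w] this beats the union bound over the
    [2 ^ n] sets, so with high probability all the sets contain about as many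
    edges as expected ([sbm_edges_concentrate]). No further event is necessary,
    because volumes are determined by such counts ([vol_edges_in]). On this
    event the modularity of every partition is close to
    [(a - b) / (a + (k - 1) * b)] times the quadratic form
    [k * \sum_i \sum_j x i j ^+ 2 - \sum_i (\sum_j x i j) ^+ 2], called [energy]
    below ([modularity_near_energy]).

    What remains is to maximise [energy] over nonnegative matrices with column
    sums about [1 / k] and diagonal sum [1 - d], for a labelling of the parts
    that attains the distance. Such a matrix is the diagonal matrix of its
    column sums plus a nonnegative combination, of total weight [d], of
    elementary moves from a diagonal entry [(j, j)] to an entry [(i, j)]. The
    part of [energy] that is linear in the moves is about [- 2 * d] whatever the
    moves are, and the quadratic part is largest when all the moves coincide:
    this gives the upper bound [hfun k d] ([energy_le]). It is attained by
    relocating about [d * n] vertices from one planted part to another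
    ([energy_move_ge]); as [d <= 1 / k], relabelling the parts does not bring
    this partition closer to the planted one ([kdist_relocate]). *)

Set Implicit Arguments.
Unset Strict Implicit.
Unset Printing Implicit Defensive.

Import Order.TTheory GRing.Theory Num.Theory.
Local Open Scope ring_scope.

(** * Counting edges and degrees *)

(** A pair [e] meets [A] in [1 + (e \subset A) - (e \subset ~: A)] points, so
    volumes, like the total number of edges, are determined by the numbers of
    edges inside sets. *)
Lemma vol_edges_in (V : finType) (E : {set {set V}}) (A : {set V}) :
  simple_graph E ->
  (vol E A + edges_in E (~: A) = #|E| + edges_in E A)%N.
Proof.
move=> sE; rewrite /vol /edges_in -!sum1_card.
rewrite (eq_bigr (fun v => \sum_(e in E) (v \in e : nat))%N); last first.
  move=> v _; rewrite /degree -sum1_card.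
  rewrite big_mkcond [RHS]big_mkcond; apply: eq_bigr => e _.
  by rewrite inE; case: (e \in E); case: (v \in e).
rewrite exchange_big /=.
have ind (B : {set V}) : (\sum_(e in [set e in E | e \subset B]) 1
    = \sum_(e in E) (e \subset B : nat))%N.
  rewrite big_mkcond [RHS]big_mkcond; apply: eq_bigr => e _.
  by rewrite inE; case: (e \in E); case: (e \subset B).
rewrite !ind -!big_split /=; apply: eq_bigr => e eE.
have /eqP e2 : #|e| == 2%N by have := subsetP sE e eE; rewrite inE.
have -> : (\sum_(v in A) (v \in e) = #|e :&: A|)%N.
  rewrite -sum1_card big_mkcond [RHS]big_mkcond; apply: eq_bigr => v _.
  by rewrite inE andbC; case: (v \in A); case: (v \in e).
have h1 : (e \subset A) = (#|e :&: A| == 2%N).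
  apply/idP/eqP => [/setIidPl-> //|h]; apply/setIidPl/eqP.
  by rewrite eqEcard subsetIl e2 h.
have h2 : (e \subset ~: A) = (#|e :&: A| == 0%N).
  by rewrite -disjoints_subset -setI_eq0 cards_eq0.
have : (#|e :&: A| <= 2)%N by rewrite -e2 subset_leq_card ?subsetIl.
by rewrite h1 h2; case: (#|e :&: A|) => [|[|[|]]].
Qed.

Lemma edges_in_setT (V : finType) (E : {set {set V}}) :
  edges_in E [set: V] = #|E|.
Proof. by apply: eq_card => e; rewrite inE subsetT andbT. Qed.

Lemma edges_in_set0 (V : finType) (E : {set {set V}}) :
  simple_graph E -> edges_in E set0 = 0%N.
Proof.
move=> sE; apply/eqP; rewrite cards_eq0; apply/eqP/setP => e.
rewrite !inE subset0; apply/negP => /andP[eE /eqP e0].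
by have := subsetP sE e eE; rewrite inE e0 cards0.
Qed.

Lemma kpart_eq (V : finType) (k : nat) (P : 'I_k -> {set V}) (i j : 'I_k)
    (v : V) :
  kpart_partition P -> v \in P i -> v \in P j -> i = j.
Proof.
by move=> hP vi vj; have [l [_ ul]] := hP v; rewrite -(ul _ vi) -(ul _ vj).
Qed.

Lemma kpart_sum (V : finType) (k : nat) (P : 'I_k -> {set V}) (A : {set V}) :
  kpart_partition P -> (\sum_(i < k) #|A :&: P i| = #|A|)%N.
Proof.
move=> hP; rewrite -[RHS]sum1_card.
rewrite (eq_bigr (fun i => \sum_(v in A) (v \in P i : nat))%N); last first.
  move=> i _; rewrite -sum1_card big_mkcond [RHS]big_mkcond.
  by apply: eq_bigr => v _; rewrite inE; case: (v \in A); case: (v \in P i).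
rewrite exchange_big /=; apply: eq_bigr => v _.
have [i [vi ui]] := hP v.
rewrite (bigD1 i) //= vi big1 // => j ji.
by apply/eqP; rewrite eqb0; apply: contraNN ji => /ui ->.
Qed.

Lemma kpart_card (V : finType) (k : nat) (P : 'I_k -> {set V}) :
  kpart_partition P -> (\sum_(i < k) #|P i| = #|V|)%N.
Proof.
move=> hP; rewrite -cardsT -(kpart_sum [set: V] hP).
by apply: eq_bigr => i _; rewrite setTI.
Qed.

Lemma edges_inE (R : realType) (V : finType) (E : {set {set V}}) (A : {set V}) :
  simple_graph E ->
  (edges_in E A)%:R = \sum_(e in vpairs V | e \subset A) (e \in E)%:R :> R.
Proof.
move=> sE; rewrite /edges_in -sum1_card natr_sum.
rewrite [LHS]big_mkcond [RHS]big_mkcond; apply: eq_bigr => e _.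
rewrite inE; case: (boolP (e \in E)) => /= eE; last by case: ifP.
by rewrite (subsetP sE e eE).
Qed.

Lemma natr_bin2 (R : realFieldType) (n : nat) :
  'C(n, 2)%:R = (n%:R ^+ 2 - n%:R) / 2 :> R.
Proof.
elim: n => [|n IHn]; first by rewrite bin0n expr0n subrr mul0r.
by rewrite binS natrD IHn bin1 -natr1; field.
Qed.

(** * Concentration of all edge counts *)

Definition mean_edges (R : realType) (V : finType) (k : nat) (p q : R)
    (P : 'I_k -> {set V}) (A : {set V}) : R :=
  \sum_(e in vpairs V | e \subset A) edge_prob p q P e.

Lemma sbm_expect_prod (R : realType) (V : finType) (k : nat) (p q : R)
    (P : 'I_k -> {set V}) (u v : {set V} -> R) :
  \sum_(E : {set {set V}} | simple_graph E)
      sbm_weight p q P E * \prod_(e in vpairs V) (if e \in E then u e else v e)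
  = \prod_(e in vpairs V)
      (edge_prob p q P e * u e + (1 - edge_prob p q P e) * v e).
Proof.
pose f e := if e \in vpairs V then edge_prob p q P e * u e else 0.
pose g e := if e \in vpairs V then (1 - edge_prob p q P e) * v e else 1.
have -> : \prod_(e in vpairs V)
      (edge_prob p q P e * u e + (1 - edge_prob p q P e) * v e)
    = \prod_(e : {set V}) (f e + g e).
  rewrite [LHS]big_mkcond; apply: eq_bigr => e _.
  by rewrite /f /g; case: ifP; rewrite ?add0r.
rewrite bigA_distr [RHS](bigID (fun E => simple_graph E)) /=.
rewrite [X in _ = _ + X]big1 ?addr0; last first.
  move=> E /subsetPn[e eE eN]; rewrite (bigD1 e) //= eE /f (negbTE eN).
  by rewrite mul0r.
apply: eq_bigr => E sE.
rewrite /sbm_weight -big_split /= big_mkcond; apply: eq_bigr => e _.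
rewrite /f /g; case: ifP => eN; case: ifP => // eE.
by rewrite (subsetP sE e eE) in eN.
Qed.

Lemma edge_prob_itv (R : realType) (V : finType) (k : nat) (p q : R)
    (P : 'I_k -> {set V}) (e : {set V}) :
  0 <= p <= 1 -> 0 <= q <= 1 -> 0 <= edge_prob p q P e <= 1.
Proof. by rewrite /edge_prob; case: ifP. Qed.

Lemma sbm_weight_ge0 (R : realType) (V : finType) (k : nat) (p q : R)
    (P : 'I_k -> {set V}) (E : {set {set V}}) :
  0 <= p <= 1 -> 0 <= q <= 1 -> 0 <= sbm_weight p q P E.
Proof.
move=> hp hq; apply: prodr_ge0 => e _.
have /andP[h0 h1] := edge_prob_itv P e hp hq.
by case: ifP => // _; rewrite subr_ge0.
Qed.

(** Markov's inequality with an arbitrary test function: choosing for [Z] a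
    sum of exponentials gives Chernoff bounds and their union bound at once. *)
Lemma sbm_prob_ge (R : realType) (V : finType) (k : nat) (p q : R)
    (P : 'I_k -> {set V}) (event : {set {set V}} -> Prop)
    (Z : {set {set V}} -> R) :
  0 <= p <= 1 -> 0 <= q <= 1 ->
  (forall E, 0 <= Z E) ->
  (forall E, simple_graph E -> ~ event E -> 1 <= Z E) ->
  1 - \sum_(E : {set {set V}} | simple_graph E) sbm_weight p q P E * Z E
    <= sbm_prob p q P event.
Proof.
move=> hp hq Z0 Z1; rewrite -(sbm_prob_total p q P) /sbm_prob.
under eq_bigl => E do rewrite asboolT // andbT.
rewrite lerBlDr (bigID (fun E => `[< event E >])) /=.
apply: lerD => //.
rewrite [leRHS](bigID (fun E => `[< event E >])) /=.
rewrite -[leLHS]add0r; apply: lerD.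
  by apply: sumr_ge0 => E _; rewrite mulr_ge0 // sbm_weight_ge0.
apply: ler_sum => E /andP[sE /asboolPn nE].
by rewrite ler_peMr ?Z1 // sbm_weight_ge0.
Qed.

(** A quadratic upper bound near 0; it follows from
    [1 - x <= expR (- x)] and [1 / (1 - x) = 1 + x + x ^+ 2 / (1 - x)]. *)
Lemma expR_le_quadratic (R : realType) (x : R) :
  x <= 2^-1 -> expR x <= 1 + x + 2 * x ^+ 2.
Proof.
move=> hx; have := expR_ge1Dx (- x); have := expRxMexpNx_1 x.
have := expR_gt0 x; set y := expR x; set z := expR (- x) => y0 yz hz.
have : y * (1 - x) <= y * z by rewrite ler_pM2l.
rewrite yz.
move=> h; rewrite -(@ler_pM2r _ (1 - x)); last by lra.
apply: le_trans h _.
have : 0 <= x ^+ 2 * (1 - 2 * x) by rewrite mulr_ge0 ?sqr_ge0 //; lra.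
lra.
Qed.

(** Independence turns the moment generating function into a product, and each
    factor [expR (- s w) (1 + w (expR s - 1))] is at most [expR (2 w s^2)]. *)
Lemma sbm_mgf (R : realType) (V : finType) (k : nat) (p q : R)
    (P : 'I_k -> {set V}) (A : {set V}) (s : R) :
  0 <= p <= 1 -> 0 <= q <= 1 -> s <= 2^-1 ->
  \sum_(E : {set {set V}} | simple_graph E)
      sbm_weight p q P E
      * expR (s * ((edges_in E A)%:R - mean_edges p q P A))
  <= expR (2 * s ^+ 2 * mean_edges p q P A).
Proof.
move=> hp hq hs; pose w := edge_prob p q P.
pose u (e : {set V}) := if e \subset A then expR (s * (1 - w e)) else 1.
pose v (e : {set V}) := if e \subset A then expR (s * (0 - w e)) else 1.
rewrite (eq_bigr (fun E => sbm_weight p q P E *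
    \prod_(e in vpairs V) (if e \in E then u e else v e))); last first.
  move=> E sE; congr (_ * _); rewrite edges_inE // /mean_edges -sumrB.
  rewrite mulr_sumr expR_sum big_mkcondr /=; apply: eq_bigr => e _.
  by rewrite /u /v /w; case: ifP; case: ifP.
rewrite sbm_expect_prod /mean_edges mulr_sumr expR_sum [leRHS]big_mkcondr /=.
apply: ler_prod => e _; rewrite /u /v -/w.
have /andP[w0 w1] : 0 <= w e <= 1 by exact: edge_prob_itv.
have [_|_] := boolP (e \subset A); last first.
  by rewrite !mulr1 subrKC ler01 lexx.
apply/andP; split.
  by rewrite addr_ge0 // mulr_ge0 ?expR_ge0 // subr_ge0.
have -> : w e * expR (s * (1 - w e)) + (1 - w e) * expR (s * (0 - w e))
    = expR (- (s * w e)) * (1 + w e * (expR s - 1)).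
  by rewrite sub0r mulrN mulrBr mulr1 expRD; ring.
have h1 : 1 + w e * (expR s - 1) <= expR (w e * (s + 2 * s ^+ 2)).
  apply: le_trans (expR_ge1Dx _); rewrite lerD2l ler_wpM2l //.
  by have := expR_le_quadratic hs; lra.
apply: le_trans (ler_wpM2l (expR_ge0 _) h1) _.
rewrite -expRD ler_expR le_eqVlt; apply/orP; left; apply/eqP.
by rewrite -/(w e); ring.
Qed.

Lemma sbm_concentration (R : realType) (V : finType) (k : nat) (p q : R)
    (P : 'I_k -> {set V}) (event : {set {set V}} -> Prop) (M s t : R) :
  0 <= p <= 1 -> 0 <= q <= 1 -> 0 <= s <= 2^-1 ->
  (forall A, mean_edges p q P A <= M) ->
  (forall E, simple_graph E ->
    (forall A, `|(edges_in E A)%:R - mean_edges p q P A| <= t) -> event E) ->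
  1 - 2 * 2 ^+ #|V| * expR (2 * s ^+ 2 * M - s * t) <= sbm_prob p q P event.
Proof.
move=> hp hq /andP[s0 s2] hM hE.
pose X (E : {set {set V}}) A := (edges_in E A)%:R - mean_edges p q P A.
pose Z E := \sum_(A : {set V})
  expR (- (s * t)) * (expR (s * X E A) + expR (- s * X E A)).
apply: le_trans (@sbm_prob_ge R V k p q P event Z hp hq _ _); first last.
- move=> E sE nE; apply: contrapT => /negP; rewrite -ltNge => Z1; apply: nE.
  apply: hE => // A; rewrite -/(X E A) leNgt; apply/negP => tX.
  suff : 1 <= Z E by rewrite leNgt Z1.
  rewrite /Z (bigD1 A) //=.
  apply: ler_wpDr.
    by apply: sumr_ge0 => B _; rewrite mulr_ge0 ?addr_ge0 ?expR_ge0.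
  rewrite mulrDr -!expRD.
  have e0 := expR_ge0 (- (s * t) + s * X E A).
  have e0' := expR_ge0 (- (s * t) + - s * X E A).
  (* One of the two exponents is nonnegative, which makes its term at least 1. *)
  have key y : t <= y -> 1 <= expR (- (s * t) + s * y).
    move=> ty; apply: le_trans (expR_ge1Dx _).
    by rewrite lerDl addrC subr_ge0 ler_wpM2l.
  have [X0|X0] := leP 0 (X E A).
    have := key (X E A); rewrite ger0_norm // in tX => /(_ (ltW tX)); lra.
  have := key (- X E A); rewrite ltr0_norm // in tX => /(_ (ltW tX)).
  by rewrite mulrN -mulNr; lra.
- by move=> E; apply: sumr_ge0 => B _; rewrite mulr_ge0 ?addr_ge0 ?expR_ge0.
rewrite lerD2l lerN2 /Z.
under eq_bigr => E _ do rewrite mulr_sumr.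
rewrite exchange_big /=.
apply: (@le_trans _ _ (\sum_(A : {set V})
   expR (- (s * t)) * (2 * expR (2 * s ^+ 2 * M)))).
  apply: ler_sum => A _.
  under eq_bigr => E _ do rewrite mulrCA mulrDr.
  rewrite -mulr_sumr big_split /= ler_wpM2l ?expR_ge0 //.
  have mono r : 2 * r ^+ 2 * mean_edges p q P A <= 2 * r ^+ 2 * M.
    by rewrite ler_wpM2l // mulr_ge0 ?sqr_ge0.
  have h1 := sbm_mgf P A hp hq s2.
  have h2 : - s <= 2^-1 by lra.
  have {}h2 := sbm_mgf P A hp hq h2.
  rewrite sqrrN in h2.
  have h3 : expR (2 * s ^+ 2 * mean_edges p q P A) <= expR (2 * s ^+ 2 * M).
    by rewrite ler_expR.
  rewrite /X; lra.
rewrite sumr_const -(cardsT {set V}) -powersetT card_powerset cardsT.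
rewrite -[_ *+ (2 ^ _)]mulr_natl natrX expRD.
rewrite le_eqVlt; apply/orP; left; apply/eqP; ring.
Qed.

(** Chernoff's bound has exponent of order [w * #|V|], which for large [w] beats
    the number [2 ^ #|V|] of sets. *)
Lemma sbm_edges_concentrate (R : realType) (a b t eps : R) :
  0 < b -> b < a -> 0 < t -> 0 < eps ->
  exists2 c : R, 0 <= c &
  forall (V : finType) (k : nat) (P : 'I_k -> {set V}) (w : R)
    (event : {set {set V}} -> Prop),
  let p := w * a / #|V|%:R in
  let q := w * b / #|V|%:R in
  (0 < #|V|)%N -> c < w -> 0 <= p <= 1 -> 0 <= q <= 1 ->
  (forall E, simple_graph E ->
    (forall A, `|(edges_in E A)%:R - mean_edges p q P A|
       <= t / 2 * (w * #|V|%:R)) -> event E) ->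
  1 - eps <= sbm_prob p q P event.
Proof.
move=> b0 ab t0 eps0.
have a0 : 0 < a by lra.
(* [s * a <= t / 4] makes the quadratic term of the exponent at most half of the
   linear one, and [s <= 2^-1] is the range of the quadratic bound. *)
pose s := Num.min 2^-1 (t / (4 * a)).
have s0 : 0 < s by rewrite lt_min divr_gt0 //; lra.
have s2 : s <= 2^-1 by rewrite ge_min lexx.
have sa : s * a <= t / 4.
  have : s <= t / (4 * a) by rewrite ge_min lexx orbT.
  move=> /(ler_wpM2r (ltW a0)) h; apply: le_trans h _.
  by rewrite le_eqVlt; apply/orP; left; apply/eqP; field; lra.
(* The bound will be [2 * (2 * expR (- L)) ^+ n]; as [expR (- L) <= (1 + L)^-1],
   this [L] makes [2 * expR (- L)] at most both [1] and [eps / 2]. *)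
pose L := 4 / eps + 2.
have L0 : 0 < L by have : 0 < 4 / eps by [rewrite divr_gt0]; rewrite /L; lra.
have st0 : 0 < s * t by rewrite mulr_gt0.
exists (4 * L / (s * t)); first by rewrite divr_ge0 //; lra.
move=> V k P w event p q V0 cw hp hq hE.
set n : R := #|V|%:R in p q hp hq hE *.
have n0 : 0 < n by rewrite ltr0n.
have w0 : 0 < w by apply: le_lt_trans cw; rewrite divr_ge0 //; lra.
have qp : q <= p.
  by rewrite ler_wpM2r ?invr_ge0 ?(ltW n0) // ler_wpM2l ?ltW.
have p0 : 0 <= p by case/andP: hp.
have hM A : mean_edges p q P A <= n * w * a / 2.
  apply: (@le_trans _ _ (\sum_(e in vpairs V) p)).
    rewrite /mean_edges big_mkcondr /=; apply: ler_sum => e _.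
    by rewrite /edge_prob; case: ifP => // _; case: ifP.
  rewrite sumr_const -[_ *+ _]mulr_natl /vpairs card_draws natr_bin2 -/n.
  have -> : n * w * a / 2 = n ^+ 2 / 2 * p by rewrite /p; field; lra.
  by rewrite ler_wpM2r //; lra.
have s02 : 0 <= s <= 2^-1 by rewrite ltW.
apply: le_trans (sbm_concentration hp hq s02 hM hE).
rewrite lerD2l lerN2.
pose y := 2 * expR (- L).
have expo : 2 * s ^+ 2 * (n * w * a / 2) - s * (t / 2 * (w * n)) <= - L * n.
  have swn : 0 <= s * w * n by rewrite !mulr_ge0 // ltW.
  have := ler_wpM2l swn sa.
  have : L * n <= w * (s * t) / 4 * n.
    rewrite ler_wpM2r ?(ltW n0) //.
    by move: cw; rewrite ltr_pdivrMr //; lra.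
  lra.
apply: (@le_trans _ _ (2 * y ^+ #|V|)).
  rewrite exprMn -expRM_natr -/n -mulrA ler_wpM2l // ler_wpM2l ?exprn_ge0 //.
  by rewrite ler_expR.
have eL : expR (- L) * (1 + L) <= 1.
  rewrite -[leRHS](expRxMexpNx_1 L) [leRHS]mulrC ler_wpM2l ?expR_ge0 //.
  exact: expR_ge1Dx.
have y0 : 0 <= y by rewrite mulr_ge0 ?expR_ge0.
have eN0 := expR_ge0 (- L).
have y1 : y <= 1.
  have : expR (- L) * 2 <= expR (- L) * (1 + L).
    rewrite ler_wpM2l //; have : 0 < 4 / eps by rewrite divr_gt0.
    by rewrite /L; lra.
  by rewrite /y; lra.
have ye : 2 * y <= eps.
  have : expR (- L) * (4 / eps) <= expR (- L) * (1 + L).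
    by rewrite ler_wpM2l // /L; lra.
  move=> /le_trans/(_ eL); rewrite mulrA ler_pdivrMr // mul1r /y; lra.
have : y ^+ #|V| <= y.
  by rewrite -(prednK V0) exprS ler_piMr // exprn_ile1.
lra.
Qed.

(** * The extremal problem for overlap matrices *)

Definition energy (R : pzRingType) (I : finType) (x : I -> I -> R) : R :=
  #|I|%:R * (\sum_i \sum_j x i j ^+ 2) - \sum_i (\sum_j x i j) ^+ 2.

Lemma sum_sqr_le_sqr_sum (R : realFieldType) (I : finType) (P : pred I)
    (f : I -> R) :
  (forall i, P i -> 0 <= f i) ->
  \sum_(i | P i) f i ^+ 2 <= (\sum_(i | P i) f i) ^+ 2.
Proof.
move=> f0; rewrite [leRHS]expr2 mulr_suml; apply: ler_sum => i Pi.
rewrite expr2 ler_wpM2l ?f0 // (bigD1 i) //= lerDl.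
by apply: sumr_ge0 => j /andP[/f0].
Qed.

Lemma sum_sqr_near_uniform (R : realFieldType) (I : finType) (f : I -> R)
    (t : R) :
  (0 < #|I|)%N -> \sum_i f i = 1 -> (forall i, `|f i - #|I|%:R^-1| <= t) ->
  #|I|%:R^-1 <= \sum_i f i ^+ 2 <= #|I|%:R^-1 + #|I|%:R * t ^+ 2.
Proof.
move=> I0 f1 ft.
have k0 : #|I|%:R != 0 :> R by rewrite pnatr_eq0 -lt0n.
have -> : \sum_i f i ^+ 2 = #|I|%:R^-1 + \sum_i (f i - #|I|%:R^-1) ^+ 2.
  have sqE i : (f i - #|I|%:R^-1) ^+ 2
      = f i ^+ 2 + #|I|%:R^-1 ^+ 2 - 2 * #|I|%:R^-1 * f i by ring.
  rewrite (eq_bigr _ (fun i _ => sqE i)) sumrB big_split /=.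
  by rewrite sumr_const -mulr_sumr f1 -[_ *+ #|I|]mulr_natl; field.
rewrite lerDl lerD2l; apply/andP; split.
  by apply: sumr_ge0 => i _; exact: sqr_ge0.
apply: le_trans (ler_sum _ (_ : forall i, xpredT i -> _ <= t ^+ 2)) _.
  move=> i _; rewrite -real_normK ?num_real // lerXn2r ?nnegrE //.
  exact: le_trans (normr_ge0 _) (ft i).
by rewrite sumr_const mulr_natl.
Qed.

(** Writing [x] as the diagonal matrix of its column sums plus a perturbation
    that moves mass off the diagonal, the quadratic part of the perturbation is
    largest when all the mass [D] moves within one column and to one row: this
    reduces to [y j + z j <= D], as the [j]-th row and the [j]-th column have no
    off-diagonal entry in common. *)
Lemma energy_le (R : realFieldType) (I : finType) (x : I -> I -> R) (t : R) :
  (2 <= #|I|)%N -> (forall i j, 0 <= x i j) ->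
  \sum_j \sum_i x i j = 1 ->
  (forall j, `|\sum_i x i j - #|I|%:R^-1| <= t) ->
  let k := #|I|%:R in
  let D := 1 - \sum_i x i i in
  energy x <= 1 - k^-1 - 2 * D * (1 - D * (k - 1))
              + 2 * k * D * t + k * (k - 1) * t ^+ 2.
Proof.
move=> I2 x0 x1 xt; cbv zeta.
set k := #|I|%:R; set D := 1 - \sum_i x i i.
pose c j := \sum_i x i j.
pose y j := \sum_(i | i != j) x i j.
pose z i := \sum_(j | j != i) x i j.
pose X := \sum_i \sum_(j | j != i) x i j ^+ 2.
have k2 : 2 <= k by rewrite /k (ler_nat R 2).
have cE j : c j = x j j + y j by rewrite /c (bigD1 j).
have xE j : x j j = c j - y j by rewrite cE addrK.
have y0 j : 0 <= y j by apply: sumr_ge0.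
have z0 j : 0 <= z j by apply: sumr_ge0.
have DE : D = \sum_j y j.
  rewrite /D -x1 -sumrB; apply: eq_bigr => j _.
  by rewrite -/(c j) cE addrAC subrr add0r.
have Dz : D = \sum_i z i.
  rewrite /D -x1 exchange_big -sumrB; apply: eq_bigr => i _ /=.
  by rewrite (bigD1 i) //= addrAC subrr add0r.
have yzD i : y i + z i <= D.
  rewrite DE (bigD1 i) //= lerD2l; apply: ler_sum => j ji.
  by rewrite /y (bigD1 i) 1?eq_sym //= lerDl; apply: sumr_ge0.
have XZ : X <= \sum_i z i ^+ 2.
  by apply: ler_sum => i _; apply: sum_sqr_le_sqr_sum.
have XY : X <= \sum_i y i ^+ 2.
  rewrite /X; under eq_bigr => i _ do rewrite big_mkcond.
  rewrite exchange_big; apply: ler_sum => j _ /=.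
  apply: le_trans (sum_sqr_le_sqr_sum _) => //.
  rewrite [leRHS]big_mkcond /=; apply: ler_sum => i _.
  by rewrite eq_sym.
have YZ : \sum_i y i ^+ 2 + \sum_i y i * z i <= D ^+ 2.
  rewrite -big_split /= [leRHS]expr2 {1}DE mulr_suml; apply: ler_sum => i _.
  by rewrite expr2 -mulrDr ler_wpM2l.
have S2 : \sum_i \sum_j x i j ^+ 2 =
    \sum_i c i ^+ 2 - 2 * \sum_i c i * y i + \sum_i y i ^+ 2 + X.
  rewrite mulr_sumr -sumrB -!big_split /=; apply: eq_bigr => i _.
  by rewrite (bigD1 i) //= xE; ring.
have R2 : \sum_i (\sum_j x i j) ^+ 2 =
    \sum_i c i ^+ 2 + \sum_i y i ^+ 2 + \sum_i z i ^+ 2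
    - 2 * \sum_i c i * y i + 2 * \sum_i c i * z i - 2 * \sum_i y i * z i.
  rewrite !mulr_sumr -!(big_split, sumrB) /=; apply: eq_bigr => i _.
  by rewrite (bigD1 i) //= xE -/(z i); ring.
have lo (f : I -> R) : (forall i, 0 <= f i) -> \sum_i f i = D ->
    (k^-1 - t) * D <= \sum_i c i * f i.
  move=> f0 <-; rewrite mulr_sumr; apply: ler_sum => i _.
  rewrite ler_wpM2r //; have := xt i; rewrite ler_norml -/(c i) -/k; lra.
(* The linear part of the energy of the perturbation: each of the two sums
   below is at least about [D / k]. *)
have cy := lo y y0 (esym DE).
have cz := lo z z0 (esym Dz).
have I0 : (0 < #|I|)%N by exact: ltnW.
have /andP[_] := sum_sqr_near_uniform I0 x1 xt; rewrite -/k => C2.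
rewrite /energy S2 R2 -/k.
set SC := \sum_i c i ^+ 2 in S2 R2 *; rewrite -/SC in C2.
have kD : (k - 1) * ((k^-1 - t) * D) <= (k - 1) * \sum_i c i * y i.
  by rewrite ler_wpM2l //; lra.
have kC : (k - 1) * SC <= (k - 1) * (k^-1 + k * t ^+ 2).
  by rewrite ler_wpM2l //; lra.
have kX : (k - 1) * X <= (k - 1) * \sum_i y i ^+ 2.
  by rewrite ler_wpM2l //; lra.
have kY : (k - 1) * (\sum_i y i ^+ 2 + \sum_i y i * z i) <= (k - 1) * D ^+ 2.
  by rewrite ler_wpM2l //; lra.
have kZ : 0 <= (k - 2) * \sum_i y i * z i.
  by rewrite mulr_ge0 ?subr_ge0 ?sumr_ge0 // => i _; rewrite mulr_ge0.
have kk : k * k^-1 = 1 by rewrite divff //; lra.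
have kkD : k * (k^-1 * D) = D by rewrite mulrA kk mul1r.
move: kD kC kX kY kZ kk kkD cz XZ.
move: (\sum_i y i ^+ 2) (\sum_i z i ^+ 2) (\sum_i y i * z i)
  (\sum_i c i * y i) (\sum_i c i * z i) => Y Z W CY CZ.
move: k^-1 => ki; clear; nra.
Qed.

(** The bound of [energy_le] is attained, up to the imbalance of the column
    sums, by moving mass [D] from one diagonal entry to another row of the same
    column. *)
Lemma energy_move_ge (R : realFieldType) (I : finType) (c : I -> R) (t D : R)
    (i0 i1 : I) (x : I -> I -> R) :
  i0 != i1 -> \sum_j c j = 1 -> (forall j, `|c j - #|I|%:R^-1| <= t) ->
  0 <= D ->
  (forall i j, x i j = (i == j)%:R * c j
     + D * (((i == i1) && (j == i0))%:R - ((i == i0) && (j == i0))%:R)) ->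
  let k := #|I|%:R in
  1 - k^-1 - 2 * D * (1 - D * (k - 1)) - 2 * k * D * t <= energy x.
Proof.
move=> i01 c1 ct D0 xE; cbv zeta; set k := #|I|%:R.
have I2 : (2 <= #|I|)%N.
  by have := max_card (pred_of_set [set i0; i1]); rewrite cards2 i01.
have k2 : 2 <= k by rewrite /k (ler_nat R 2).
have I0 : (0 < #|I|)%N by exact: ltnW.
have [n10 n01] : (i1 == i0 = false) * (i0 == i1 = false).
  by rewrite eq_sym (negbTE i01).
have /andP[C2 _] := sum_sqr_near_uniform I0 c1 ct.
have two (f : I -> R) : \sum_i f i
    = f i0 + (f i1 + \sum_(i | (i != i0) && (i != i1)) f i).
  by rewrite (bigD1 i0) //= (bigD1 i1) // n10.
have row i : \sum_j x i j = c i + D * ((i == i1)%:R - (i == i0)%:R).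
  under eq_bigr => j _ do rewrite xE.
  rewrite big_split /= -mulr_sumr sumrB; congr (_ + D * (_ - _)).
  - by rewrite (bigD1 i) //= eqxx mul1r big1 ?addr0 // => j /negbTE;
      rewrite eq_sym => ->; rewrite mul0r.
  - rewrite (bigD1 i0) //= eqxx andbT big1 ?addr0 // => j /negbTE j0.
    by rewrite j0 andbF.
  - rewrite (bigD1 i0) //= eqxx andbT big1 ?addr0 // => j /negbTE j0.
    by rewrite j0 andbF.
have col j : \sum_i x i j ^+ 2
    = c j ^+ 2 + (j == i0)%:R * (2 * D ^+ 2 - 2 * D * c i0).
  have [->|j0] := eqVneq j i0; last first.
    rewrite mul0r addr0 (bigD1 j) //= big1 ?addr0.
      by rewrite xE eqxx (negbTE j0) !andbF /=; ring.
    by move=> i ij; rewrite xE (negbTE ij) (negbTE j0) !andbF /=; ring.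
  rewrite (bigD1 i0) //= (bigD1 i1) ?n10 //= big1 ?addr0.
    by rewrite !xE !eqxx ?n10 ?n01 /=; ring.
  move=> i /andP[ii0 ii1].
  by rewrite xE (negbTE ii0) (negbTE ii1) /=; ring.
have S2 : \sum_i \sum_j x i j ^+ 2
    = \sum_i c i ^+ 2 + (2 * D ^+ 2 - 2 * D * c i0).
  rewrite exchange_big /=; under eq_bigr => j _ do rewrite col.
  rewrite big_split /=; congr (_ + _).
  rewrite (bigD1 i0) //= eqxx mul1r big1 ?addr0 // => j /negbTE->.
  by rewrite mul0r.
have R2 : \sum_i (\sum_j x i j) ^+ 2 = \sum_i c i ^+ 2
    + (2 * D * c i1 - 2 * D * c i0 + 2 * D ^+ 2).
  under eq_bigr => i _ do rewrite row.
  rewrite !two !eqxx n10 n01 [X in _ + (_ + X)](eq_bigr (fun i => c i ^+ 2)).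
    by rewrite /=; ring.
  by move=> i /andP[/negbTE ii0 /negbTE ii1]; rewrite ii0 ii1 /=; ring.
rewrite /energy S2 R2 -/k.
have kC : (k - 1) * k^-1 <= (k - 1) * \sum_i c i ^+ 2.
  by rewrite ler_wpM2l //; lra.
have hi j : c j * D <= (k^-1 + t) * D.
  by rewrite ler_wpM2r //; have := ct j; rewrite ler_norml -/k; lra.
have h0 : (k - 1) * (c i0 * D) <= (k - 1) * ((k^-1 + t) * D).
  by rewrite ler_wpM2l //; lra.
have h1 := hi i1.
have kk : k * k^-1 = 1 by rewrite divff //; lra.
have kkD : k * (k^-1 * D) = D by rewrite mulrA kk mul1r.
move: kC h0 h1 kk kkD; move: k^-1 (\sum_i c i ^+ 2) => ki S.
move: (c i0) (c i1) => d0 d1; clear; nra.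
Qed.

(** * Partitions, padding and the distance to the planted partition *)

Lemma sum_padded (R : nmodType) (V : finType) (k : nat) (AA : {set {set V}})
    (f : {set V} -> R) :
  (#|AA| <= k)%N -> f set0 = 0 ->
  \sum_(A in AA) f A = \sum_(i < k) f (padded AA i).
Proof.
move=> AAk f0; rewrite -big_enum (big_nth set0) -cardE /padded.
rewrite -(big_mkord xpredT (fun i => f (nth set0 (enum AA) i))).
rewrite [RHS](big_cat_nat (n := #|AA|)) //=.
rewrite [X in _ = _ + X]big_nat_cond [X in _ = _ + X]big1 ?addr0 //.
move=> i /andP[/andP[ik _] _].
by rewrite nth_default // -cardE.
Qed.

Lemma padded_kpart (V : finType) (k : nat) (AA : {set {set V}}) :
  partition AA [set: V] -> (#|AA| <= k)%N ->
  kpart_partition (@padded V k AA).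
Proof.
move=> pAA AAk v; have := pAA => /and3P[/eqP covA tA _].
have vc : v \in cover AA by rewrite covA inE.
set A := pblock AA v.
have AAA : A \in AA by rewrite pblock_mem.
have vA : v \in A by rewrite mem_pblock.
have ik : (index A (enum AA) < k)%N.
  by apply: leq_trans AAk; rewrite cardE index_mem mem_enum.
exists (Ordinal ik); split; first by rewrite /padded /= nth_index ?mem_enum.
move=> j; rewrite /padded => vj; apply: val_inj => /=.
have [js|js] := ltnP j (size (enum AA)); last first.
  by rewrite nth_default // inE in vj.
have jA : nth set0 (enum AA) j \in AA by rewrite -mem_enum mem_nth.
by rewrite /A (def_pblock tA jA vj) index_uniq ?enum_uniq.
Qed.

Definition nonempty_parts (V : finType) (k : nat) (B : 'I_k -> {set V}) :
  {set {set V}} := [set B i | i : 'I_k & B i != set0].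

Lemma nonempty_partsP (V : finType) (k : nat) (B : 'I_k -> {set V}) :
  kpart_partition B ->
  partition (nonempty_parts B) [set: V] /\ (#|nonempty_parts B| <= k)%N.
Proof.
move=> hB; split; last first.
  apply: leq_trans (leq_imset_card _ _) _.
  by rewrite -[leqRHS]card_ord max_card.
apply/and3P; split.
- apply/eqP/setP => v; rewrite inE; apply/bigcupP.
  have [i [vi _]] := hB v; exists (B i) => //.
  by apply/imsetP; exists i => //; rewrite inE; apply/set0Pn; exists v.
- apply/trivIsetP => _ _ /imsetP[i _ ->] /imsetP[j _ ->] nij.
  rewrite -setI_eq0; apply/eqP/setP => v; rewrite !inE; apply/negP.
  by case/andP => vi vj; rewrite (kpart_eq hB vi vj) eqxx in nij.
- apply/negP => /imsetP[i]; rewrite inE => /negP nB B0.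
  by apply: nB; rewrite -B0.
Qed.

(** Empty parts can be repeated, so this is an equality of multisets of parts
    before it is a permutation of the indices. *)
Lemma padded_nonempty_parts (V : finType) (k : nat) (B : 'I_k -> {set V}) :
  kpart_partition B ->
  exists s : 'S_k, forall i, padded (nonempty_parts B) i = B (s i).
Proof.
move=> hB; have [_ AAk] := nonempty_partsP hB.
set AA := nonempty_parts B in AAk *.
have pe : perm_eq [tuple padded AA i | i < k] [tuple B i | i < k].
  pose ne (A : {set V}) := A != set0.
  have inj i j : ne (B i) -> B i = B j -> i = j.
    by move=> /set0Pn[v vi] eB; apply: (kpart_eq hB vi); rewrite -eB.
  have sz (s : seq {set V}) : all (predC ne) s -> s = nseq (size s) set0.
    by move=> h; apply/all_pred1P/(sub_all _ h) => A; rewrite /= negbK.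
  have padE : [seq padded AA i | i <- enum 'I_k]
      = enum AA ++ nseq (k - #|AA|) set0.
    apply: (@eq_from_nth _ set0).
      by rewrite size_map size_enum_ord size_cat size_nseq -cardE subnKC.
    move=> i; rewrite size_map size_enum_ord => ik.
    rewrite (nth_map (Ordinal ik)) ?size_enum_ord // /padded nth_enum_ord //.
    rewrite nth_cat; case: ltnP => // iA.
    by rewrite nth_default // nth_nseq; case: ifP.
  rewrite /= -!/(image _ _) /image_mem.
  have mem_enumAA : enum AA =i [seq A <- [seq B i | i <- enum 'I_k] | ne A].
    move=> A; rewrite mem_enum mem_filter. apply/idP/andP.
      move=> /imsetP[i]; rewrite inE => nB ->; split=> //.
      by rewrite map_f // mem_enum.
    by move=> [nA /mapP[i _ eA]]; apply/imsetP; exists i; rewrite // inE -eA.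
  have uF : uniq [seq A <- [seq B i | i <- enum 'I_k] | ne A].
    rewrite filter_map map_inj_in_uniq ?filter_uniq -?enumT ?enum_uniq //.
    move=> i j; by rewrite mem_filter => /andP[nB _] _; apply: inj.
  have pF := uniq_perm (enum_uniq _) uF mem_enumAA.
  have szF := perm_size pF; rewrite -cardE in szF.
  rewrite padE perm_sym -(perm_filterC ne) perm_sym; apply: perm_cat => //.
  rewrite [X in perm_eq _ X]sz ?filter_all // size_filter.
  have := count_predC ne [seq B i | i <- enum 'I_k].
  rewrite -[count ne _]size_filter -szF size_map size_enum_ord => hk.
  by rewrite -[X in (X - _)%N]hk addKn.
have /tuple_permP[s es] := pe.
exists s => i.
have := congr1 (fun t : seq _ => nth set0 t i) es.
rewrite /= !(nth_map i) -?enumT ?size_enum_ord // !nth_ord_enum.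
by rewrite !tnth_map !tnth_ord_tuple.
Qed.

Lemma kdist_perm (R : realType) (V : finType) (k : nat)
    (A B P : 'I_k -> {set V}) (s : 'S_k) :
  (forall i, A i = B (s i)) -> kdist R A P = kdist R B P.
Proof.
move=> AB; rewrite /kdist; congr (1 - _ * _%:R).
rewrite [RHS](reindex_inj (mulIg s)) /=; apply: eq_bigr => r _.
by apply: eq_bigr => i _; rewrite AB permM.
Qed.

Lemma kdistP (R : realType) (V : finType) (k : nat) (A P : 'I_k -> {set V}) :
  exists s : 'S_k,
    kdist R A P = 1 - #|V|%:R^-1 * (\sum_(i < k) #|A (s i) :&: P i|)%N%:R.
Proof.
rewrite /kdist (bigop.bigmax_eq_arg (1%g : 'S_k)) //.
by eexists.
Qed.

Definition relocate (V : finType) (k : nat) (P : 'I_k -> {set V})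
    (T : {set V}) (i1 : 'I_k) (i : 'I_k) : {set V} :=
  [set v | if v \in T then i == i1 else v \in P i].

Lemma relocate_kpart (V : finType) (k : nat) (P : 'I_k -> {set V})
    (T : {set V}) (i1 : 'I_k) :
  kpart_partition P -> kpart_partition (relocate P T i1).
Proof.
move=> hP v; case: (boolP (v \in T)) => vT.
  exists i1; split; first by rewrite inE vT eqxx.
  by move=> j; rewrite inE vT => /eqP.
have [i [vi ui]] := hP v; exists i; split; first by rewrite inE (negbTE vT).
by move=> j; rewrite inE (negbTE vT); exact: ui.
Qed.

Lemma card_relocateI (V : finType) (k : nat) (P : 'I_k -> {set V})
    (T : {set V}) (i0 i1 i j : 'I_k) :
  kpart_partition P -> T \subset P i0 ->
  (#|relocate P T i1 i :&: P j| + #|T| * ((i == i0) && (j == i0))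
   = (i == j) * #|P j| + #|T| * ((i == i1) && (j == i0)))%N.
Proof.
move=> hP TP.
have ind (A : {set V}) : (#|A| = \sum_(v : V) (v \in A))%N.
  by rewrite -sum1_card big_mkcond; apply: eq_bigr => v _; case: (v \in A).
rewrite !ind big_distrr !big_distrl -!big_split /=; apply: eq_bigr => v _.
rewrite !inE.
have [vT|vT] /= := boolP (v \in T).
  have v0 := subsetP TP v vT.
  have vP l : (v \in P l) = (l == i0).
    by apply/idP/eqP => [vl|->//]; exact: kpart_eq hP vl v0.
  rewrite vP; case: (eqVneq j i0) => [->|_].
    by rewrite !andbT mul1n muln1 mul1n addnC.
  by rewrite !andbF !muln0.
rewrite !mul0n !addn0.
have [->|nij] := eqVneq i j; first by rewrite andbb mul1n.
rewrite mul0n; apply/eqP; rewrite eqb0; apply/negP => /andP[vi vj].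
by rewrite (kpart_eq hP vi vj) eqxx in nij.
Qed.

(** No relabelling of the parts recovers the relocated vertices: a permutation
    other than the identity displaces at least two parts, of at least [#|T|]
    vertices each. *)
Lemma kdist_relocate (R : realType) (V : finType) (k : nat)
    (P : 'I_k -> {set V}) (T : {set V}) (i0 i1 : 'I_k) :
  kpart_partition P -> (0 < #|V|)%N -> i0 != i1 -> T \subset P i0 ->
  (forall i, #|T| <= #|P i|)%N ->
  kdist R (relocate P T i1) P = #|T|%:R / #|V|%:R.
Proof.
move=> hP V0 i01 TP TPi; pose B := relocate P T i1.
have sumP := kpart_card hP.
(* [B (s i)] meets [P i] in all of [P i] outside [T] when [s] fixes [i], and
   otherwise in vertices of [T] only. *)
have ovE (s : 'S_k) : (\sum_(i < k) #|B (s i) :&: P i| + #|T| * (s i0 == i0)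
    = \sum_(i < k | s i == i) #|P i| + #|T| * (s i0 == i1))%N.
  have pick j : (#|T| * (s i0 == j)
      = \sum_(i < k) #|T| * ((s i == j) && (i == i0)))%N.
    rewrite (bigD1 i0) //= eqxx andbT big1 ?addn0 // => i /negbTE->.
    by rewrite andbF muln0.
  rewrite !pick [X in _ = (X + _)%N]big_mkcond -!big_split /=.
  apply: eq_bigr => i _; rewrite (card_relocateI i1 (s i) i hP TP).
  by case: (s i == i); rewrite ?mul1n ?mul0n.
have leTV : (#|T| <= #|V|)%N by rewrite max_card.
have maxE : (\max_(s : 'S_k) \sum_(i < k) #|B (s i) :&: P i| = #|V| - #|T|)%N.
  apply/eqP; rewrite eqn_leq; apply/andP; split; last first.
    apply: leq_trans (leq_bigmax (1%g : 'S_k)); rewrite leq_subLR.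
    have := ovE 1%g; rewrite perm1 eqxx (negbTE i01) muln0 muln1 addn0.
    have -> : (\sum_(i < k | (1%g : 'S_k) i == i) #|P i| = #|V|)%N.
      by rewrite -sumP; apply: eq_bigl => i; rewrite perm1 eqxx.
    by rewrite addnC => ->.
  apply/bigmax_leqP => s _; have := ovE s.
  have [si0|si0] := eqVneq (s i0) i0.
    rewrite muln1 si0 (negbTE i01) muln0 addn0 => h.
    rewrite -(leq_add2r #|T|) h subnK // -sumP.
    by rewrite [leqRHS](bigID (fun i => s i == i)) /= leq_addr.
  (* Neither [i0] nor its image [l] is fixed by [s]. *)
  rewrite muln0 addn0 => ->; set l := s i0 in si0 *.
  have sl : s l != l by apply: contraNneq si0 => /perm_inj ->.
  have := sumP; rewrite (bigID (fun i => s i == i)) /=.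
  rewrite [X in (_ + X)%N](bigD1 i0) //=.
  rewrite [X in (_ + (_ + X))%N](bigD1 l) ?sl //=.
  have := TPi i0; have := TPi l; case: (l == i1); rewrite ?muln1 ?muln0; lia.
rewrite /kdist -/B maxE natrB //; field.
by rewrite pnatr_eq0 -lt0n.
Qed.

(** * Modularity as a function of the overlaps *)

Definition overlaps (R : realType) (V : finType) (k : nat)
    (A P : 'I_k -> {set V}) (i j : 'I_k) : R := #|A i :&: P j|%:R / #|V|%:R.

(** The mean number of edges inside [A] over [w * #|V|], for [p = w * a / #|V|]
    and [q = w * b / #|V|], up to a term of order [#|V|^-1]. *)
Definition edge_density (R : realType) (V : finType) (k : nat) (a b : R)
    (P : 'I_k -> {set V}) (A : {set V}) : R :=
  (b * (#|A|%:R / #|V|%:R) ^+ 2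
   + (a - b) * \sum_(i < k) (#|A :&: P i|%:R / #|V|%:R) ^+ 2) / 2.

Lemma mean_edgesE (R : realType) (V : finType) (k : nat) (p q : R)
    (P : 'I_k -> {set V}) (A : {set V}) :
  kpart_partition P ->
  mean_edges p q P A
  = q * 'C(#|A|, 2)%:R + (p - q) * \sum_(i < k) 'C(#|A :&: P i|, 2)%:R.
Proof.
move=> hP; rewrite /mean_edges.
have binE (B : {set V}) :
    'C(#|B|, 2)%:R = \sum_(e in vpairs V | e \subset B) 1 :> R.
  rewrite -cards_draws -sum1_card natr_sum.
  by apply: eq_bigl => e; rewrite !inE andbC.
rewrite (eq_bigr (fun e : {set V} => q + (p - q) *
    \sum_(i < k) (e \subset P i)%:R)); last first.
  move=> e; rewrite inE => /andP[/eqP e2 eA]; rewrite /edge_prob.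
  have /card_gt0P[v ve] : (0 < #|e|)%N by rewrite e2.
  have [i [vi ui]] := hP v.
  have sub_i j : e \subset P j -> j = i by move=> /subsetP/(_ v ve)/ui.
  case: existsP => [[j ej]|nE].
    have ji := sub_i j ej; rewrite (bigD1 j) //= ej big1 ?addr0.
      by rewrite mulr1 subrKC.
    move=> l lj; case: (boolP (e \subset P l)) => // /sub_i li.
    by rewrite li ji eqxx in lj.
  rewrite big1 ?mulr0 ?addr0 // => j _.
  by case: (boolP (e \subset P j)) => // ej; case: nE; exists j.
rewrite big_split /= binE mulr_sumr mulr1; congr (_ + _).
rewrite -mulr_sumr exchange_big /=; congr (_ * _); apply: eq_bigr => i _.
rewrite binE big_mkcond [RHS]big_mkcond; apply: eq_bigr => e _.
by rewrite subsetI; do 3 case: (_ \in _) || case: (_ \subset _).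
Qed.

Lemma mean_edges_density (R : realType) (V : finType) (k : nat) (a b w : R)
    (P : 'I_k -> {set V}) (A : {set V}) :
  kpart_partition P -> (0 < #|V|)%N -> w != 0 ->
  mean_edges (w * a / #|V|%:R) (w * b / #|V|%:R) P A / (w * #|V|%:R)
  = edge_density a b P A - a * (#|A|%:R / #|V|%:R) / (2 * #|V|%:R).
Proof.
move=> hP V0 w0; rewrite mean_edgesE // /edge_density natr_bin2.
have n0 : #|V|%:R != 0 :> R by rewrite pnatr_eq0 -lt0n.
have -> : \sum_(i < k) 'C(#|A :&: P i|, 2)%:R
    = (\sum_(i < k) #|A :&: P i|%:R ^+ 2 - #|A|%:R) / 2 :> R.
  rewrite -(kpart_sum A hP) natr_sum -sumrB mulr_suml.
  by apply: eq_bigr => i _; rewrite natr_bin2.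
have -> : \sum_(i < k) (#|A :&: P i|%:R / #|V|%:R) ^+ 2
    = (\sum_(i < k) #|A :&: P i|%:R ^+ 2) / #|V|%:R ^+ 2 :> R.
  by rewrite mulr_suml; apply: eq_bigr => i _; rewrite exprMn exprVn.
by field; rewrite n0.
Qed.

Lemma ratio_close (R : realFieldType) (e m F F0 t K : R) :
  0 < F0 -> 0 <= t -> t <= F0 / 4 -> `|m - F0| <= 2 * t -> `|e - F| <= t ->
  0 <= F <= K * F0 ->
  `|e / m - F / F0| <= (2 + 4 * K) * t / F0.
Proof.
move=> F00 t0 tF hm he /andP[Fge Fle].
have m0 : F0 / 2 <= m by move: hm; rewrite ler_norml; lra.
have m1 : 0 < m by lra.
have -> : e / m - F / F0 = ((e - F) * F0 - F * (m - F0)) / (m * F0).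
  by field; rewrite !gt_eqF.
rewrite normrM normfV (gtr0_norm (mulr_gt0 m1 F00)) ler_pdivrMr ?mulr_gt0 //.
apply: (@le_trans _ _ (t * F0 + (K * F0) * (2 * t))).
  apply: le_trans (ler_normB _ _) _; rewrite !normrM (gtr0_norm F00).
  apply: lerD; first by rewrite ler_wpM2r // ltW.
  by rewrite ler_pM // ?ger0_norm.
have -> : (2 + 4 * K) * t / F0 * (m * F0) = (2 + 4 * K) * t * m.
  by field; rewrite gt_eqF.
have K0 : 0 <= K by rewrite -(pmulr_lge0 _ F00); exact: le_trans Fle.
have h : 0 <= (2 + 4 * K) * t by rewrite mulr_ge0 //; lra.
have := ler_wpM2l h m0; lra.
Qed.

Lemma sqr_ratio_close (R : realFieldType) (v m al F0 t : R) :
  0 < F0 -> 0 <= t -> t <= F0 / 4 -> `|m - F0| <= 2 * t ->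
  `|v - 2 * F0 * al| <= 4 * t -> 0 <= al <= 1 -> 0 <= v <= 2 * m ->
  `|(v / (2 * m)) ^+ 2 - al ^+ 2| <= 16 * t / F0.
Proof.
move=> F00 t0 tF hm hv /andP[al0 al1] /andP[v0 v1].
have m0 : F0 / 2 <= m by move: hm; rewrite ler_norml; lra.
have m1 : 0 < 2 * m by lra.
have r0 : 0 <= v / (2 * m) by rewrite divr_ge0 // ltW.
have r1 : v / (2 * m) <= 1 by rewrite ler_pdivrMr // mul1r.
rewrite subr_sqr normrM.
have -> : 16 * t / F0 = (8 * t / F0) * 2 by field; rewrite gt_eqF.
apply: ler_pM => //; last by rewrite ger0_norm ?addr_ge0 //; lra.
have -> : v / (2 * m) - al = (v - 2 * m * al) / (2 * m).
  by field; rewrite gt_eqF //; lra.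
rewrite normrM normfV (gtr0_norm m1) ler_pdivrMr //.
have : `|v - 2 * m * al| <= 8 * t.
  have -> : v - 2 * m * al = (v - 2 * F0 * al) - (m - F0) * (2 * al) by ring.
  apply: le_trans (ler_normB _ _) _.
  have : `|(m - F0) * (2 * al)| <= 2 * t * 2.
    by rewrite normrM ler_pM // ger0_norm; lra.
  lra.
move=> /le_trans; apply.
have -> : 8 * t / F0 * (2 * m) = 8 * t * (2 * m / F0) by field; rewrite gt_eqF.
by rewrite ler_peMr //; [lra|rewrite ler_pdivlMr //; lra].
Qed.

(** When every set contains about as many edges as expected, the modularity of
    a partition depends on its overlaps only: volumes are nearly proportional
    to cardinals, and the edge and degree terms combine into [energy]. *)
Lemma modularity_near_energy (R : realType) (V : finType) (k : nat)
    (a b w t : R) (E : {set {set V}}) (P : 'I_k -> {set V})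
    (AA : {set {set V}}) :
  let F0 := (a + (k%:R - 1) * b) / (2 * k%:R) in
  0 < b -> b < a -> (2 <= k)%N -> 0 < w -> (k <= #|V|)%N ->
  simple_graph E -> kpart_partition P ->
  (forall j, `|#|P j|%:R / #|V|%:R - k%:R^-1| <= #|V|%:R^-1 :> R) ->
  a / #|V|%:R <= t -> t <= F0 / 4 ->
  (forall A, `|(edges_in E A)%:R
     - mean_edges (w * a / #|V|%:R) (w * b / #|V|%:R) P A|
     <= t / 2 * (w * #|V|%:R)) ->
  partition AA [set: V] -> (#|AA| <= k)%N ->
  `|modularity R E AA
    - (a - b) / (a + (k%:R - 1) * b) * energy (overlaps R (padded AA) P)|
  <= k%:R * (18 + 4 * k%:R) * t / F0.
Proof.
move=> F0 b0 ab k2 w0 kV sE hP hpi hat htF hE pAA AAk.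
have V0 : (0 < #|V|)%N by apply: leq_trans kV; exact: ltnW.
set n : R := #|V|%:R in hpi hat hE.
have n0 : 0 < n by rewrite /n ltr0n.
have kR : 2 <= k%:R :> R by rewrite (ler_nat R 2).
have kn : k%:R <= n by rewrite /n ler_nat.
have kb : 0 <= (k%:R - 1) * b by rewrite mulr_ge0 //; lra.
have F0E : k%:R * F0 = (a + (k%:R - 1) * b) / 2.
  by rewrite /F0; field; lra.
have F00 : 0 < F0 by rewrite divr_gt0 //; lra.
have wn0 : 0 < w * n by rewrite mulr_gt0.
have ni0 : 0 <= n^-1 by rewrite invr_ge0 ltW.
have t0 : 0 <= t by apply: le_trans hat; rewrite divr_ge0 //; lra.
pose al (A : {set V}) : R := #|A|%:R / n.
pose x (A : {set V}) j : R := #|A :&: P j|%:R / n.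
pose F A := edge_density a b P A.
have FE A : F A = (b * al A ^+ 2 + (a - b) * \sum_j x A j ^+ 2) / 2 by [].
pose e A : R := (edges_in E A)%:R / (w * n).
have x0 A j : 0 <= x A j by rewrite divr_ge0 // ltW.
have xs A : \sum_j x A j = al A.
  by rewrite -mulr_suml -natr_sum (kpart_sum A hP).
have al01 A : 0 <= al A <= 1.
  rewrite /al ler_pdivrMr // mul1r ler_nat max_card andbT.
  by rewrite divr_ge0 // ltW.
have eF A : `|e A - F A| <= t.
  have -> : e A - F A = ((edges_in E A)%:R
      - mean_edges (w * a / n) (w * b / n) P A) / (w * n) - a * al A / (2 * n).
    rewrite mulrBl mean_edges_density ?gt_eqF // -/n -/(F A) -/(al A) /e.
    by ring.
  apply: le_trans (ler_normB _ _) _.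
  have h1 : `|((edges_in E A)%:R
      - mean_edges (w * a / n) (w * b / n) P A) / (w * n)| <= t / 2.
    by rewrite normrM normfV (gtr0_norm wn0) ler_pdivrMr.
  have h2 : `|a * al A / (2 * n)| <= t / 2.
    have /andP[al0 al1] := al01 A.
    have aal : 0 <= a * al A by rewrite mulr_ge0 //; lra.
    have n20 : 0 <= 2 * n by lra.
    rewrite ger0_norm ?divr_ge0 //.
    have -> : a * al A / (2 * n) = a / n * al A / 2 by field; lra.
    have an0 : 0 <= a / n by rewrite divr_ge0 // ltW //; lra.
    have : a / n * al A <= t * 1 by rewrite ler_pM.
    lra.
  by have -> : t = t / 2 + t / 2; [field|exact: lerD].
have Fb A : 0 <= F A <= k%:R * F0.
  have /andP[al0 al1] := al01 A.
  have S0 : 0 <= \sum_j x A j ^+ 2 by apply: sumr_ge0 => j _; exact: sqr_ge0.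
  have S1 : \sum_j x A j ^+ 2 <= al A ^+ 2.
    by rewrite -xs; apply: sum_sqr_le_sqr_sum.
  have al2 : al A ^+ 2 <= 1 by rewrite expr_le1.
  rewrite F0E FE.
  have S2 := le_trans S1 al2.
  have h0 : 0 <= b * al A ^+ 2 by rewrite mulr_ge0 ?sqr_ge0 // ltW.
  have h1 : b * al A ^+ 2 <= b by rewrite ler_piMr // ltW.
  have h2 : 0 <= (a - b) * \sum_j x A j ^+ 2 by rewrite mulr_ge0 //; lra.
  have h3 : (a - b) * \sum_j x A j ^+ 2 <= a - b by rewrite ler_piMr //; lra.
  by apply/andP; split; lra.
have alT : al [set: V] = 1 by rewrite /al cardsT divff // gt_eqF.
have xT j : x [set: V] j = #|P j|%:R / n by rewrite /x setTI.
have abn : (a - b) / n <= t.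
  by apply: le_trans hat; rewrite ler_wpM2r ?invr_ge0; lra.
pose m : R := #|E|%:R / (w * n).
have mE : m = e [set: V] by rewrite /m /e edges_in_setT.
have mF : `|m - F0| <= 2 * t.
  have -> : m - F0 = (e [set: V] - F [set: V]) + (F [set: V] - F0).
    by rewrite mE addrA subrK.
  apply: le_trans (ler_normD _ _) _.
  have -> : 2 * t = t + t by ring.
  apply: lerD => //.
  have I0 : (0 < #|'I_k|)%N by rewrite card_ord; exact: ltnW.
  have ss := @sum_sqr_near_uniform R 'I_k (x [set: V]) n^-1 I0.
  have {ss}/andP[] : k%:R^-1 <= \sum_j x [set: V] j ^+ 2
      <= k%:R^-1 + k%:R * n^-1 ^+ 2.
    rewrite card_ord in ss; apply: ss => [|j]; first by rewrite xs.
    by rewrite xT.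
  move=> S0 S1.
  have -> : F [set: V] - F0
      = (a - b) / 2 * (\sum_j x [set: V] j ^+ 2 - k%:R^-1).
    by rewrite FE alT /F0; field; lra.
  have h : 0 <= (a - b) / 2 by lra.
  rewrite -subr_ge0 in S0; rewrite ger0_norm; last exact: mulr_ge0.
  have {}S1 : \sum_j x [set: V] j ^+ 2 - k%:R^-1 <= n^-1.
    have : k%:R * n^-1 ^+ 2 <= n^-1.
      by rewrite expr2 mulrA ler_piMl // ler_pdivrMr // mul1r.
    lra.
  have := ler_wpM2l h S1; lra.
have vF A : `|(vol E A)%:R / (w * n) - 2 * F0 * al A| <= 4 * t.
  have -> : (vol E A)%:R / (w * n) = m + e A - e (~: A).
    rewrite /m /e -mulrDl -mulrBl; congr (_ / _).
    by rewrite -natrD -vol_edges_in // natrD addrK.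
  have cA : al (~: A) = 1 - al A.
    rewrite -alT /al -mulrBl; congr (_ / _).
    by rewrite cardsT -(cardsC A) natrD addrAC subrr add0r.
  have cx j : x (~: A) j = x [set: V] j - x A j.
    rewrite /x setTI -mulrBl; congr (_ / _).
    rewrite setIC -setDE [A :&: _]setIC -(cardsID A (P j)) natrD.
    by rewrite addrAC subrr add0r.
  have h : F [set: V] + F A - F (~: A) - 2 * F0 * al A
      = (a - b) * \sum_j x A j * (x [set: V] j - k%:R^-1).
    have sC : \sum_j x (~: A) j ^+ 2 = \sum_j x [set: V] j ^+ 2
        + \sum_j x A j ^+ 2 - 2 * \sum_j x A j * x [set: V] j.
      rewrite mulr_sumr -big_split -sumrB; apply: eq_bigr => j _ /=.
      by rewrite cx; ring.
    have sk : \sum_j x A j * (x [set: V] j - k%:R^-1)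
        = \sum_j x A j * x [set: V] j - al A / k%:R.
      by rewrite -xs mulr_suml -sumrB; apply: eq_bigr => j _; ring.
    by rewrite !FE alT cA sC sk /F0; field; lra.
  have {}h : `|F [set: V] + F A - F (~: A) - 2 * F0 * al A| <= t.
    have nb j : `|x A j * (x [set: V] j - k%:R^-1)| <= x A j * n^-1.
      by rewrite normrM ger0_norm // ler_wpM2l // xT.
    have ab0 : 0 <= a - b by lra.
    rewrite h normrM ger0_norm //.
    apply: le_trans (ler_wpM2l ab0 (ler_norm_sum _ _ _)) _.
    apply: le_trans (ler_wpM2l ab0 (ler_sum _ (fun j _ => nb j))) _.
    rewrite -mulr_suml xs; apply: le_trans abn; rewrite ler_wpM2l //.
    by rewrite ler_piMl //; have /andP[] := al01 A.
  have hV := eF [set: V]; have hA := eF A; have hC := eF (~: A).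
  rewrite mE; move: h hV hA hC; rewrite !ler_norml; lra.
have volT : (vol E [set: V])%:R = 2 * #|E|%:R :> R.
  have := vol_edges_in [set: V] sE.
  rewrite setCT edges_in_set0 // addn0 edges_in_setT addnn => ->.
  by rewrite -mul2n natrM.
have volle A : (vol E A <= vol E [set: V])%N.
  rewrite /vol [leqRHS](bigID (mem A)) /=.
  rewrite [X in (_ <= X + _)%N](eq_bigl (mem A)) ?leq_addr // => v.
  by rewrite inE.
have m0 : F0 / 2 <= m by move: mF; rewrite ler_norml; lra.
have E0 : #|E|%:R != 0 :> R.
  by apply/eqP => E0; move: m0; rewrite /m E0 mul0r; lra.
rewrite /modularity -sumrB.
rewrite (sum_padded (k := k)) //; last first.
  by rewrite edges_in_set0 // /vol big_set0 !mul0r expr0n subrr.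
have -> : (a - b) / (a + (k%:R - 1) * b) * energy (overlaps R (padded AA) P)
    = \sum_(i < k) (F (padded AA i) / F0 - al (padded AA i) ^+ 2).
  rewrite /energy card_ord mulr_sumr -sumrB mulr_sumr; apply: eq_bigr => i _.
  rewrite FE -/(x (padded AA i)) xs.
  rewrite /F0; field; apply/andP; split; last by rewrite gt_eqF //; lra.
  by rewrite gt_eqF //; lra.
rewrite -sumrB; apply: le_trans (ler_norm_sum _ _ _) _.
have -> : k%:R * (18 + 4 * k%:R) * t / F0
    = \sum_(i < k) ((2 + 4 * k%:R) * t / F0 + 16 * t / F0).
  by rewrite sumr_const card_ord -[_ *+ k]mulr_natl; field; rewrite gt_eqF.
apply: ler_sum => i _; set A := padded AA i.
have -> : (edges_in E A)%:R / #|E|%:R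
      - ((vol E A)%:R / (vol E [set: V])%:R) ^+ 2
      - (F A / F0 - al A ^+ 2)
    = (e A / m - F A / F0)
      - (((vol E A)%:R / (w * n) / (2 * m)) ^+ 2 - al A ^+ 2).
  rewrite /e /m volT; field.
  by rewrite E0 /= !gt_eqF.
apply: le_trans (ler_normB _ _) _; apply: lerD.
  exact: ratio_close.
apply: sqr_ratio_close => //; apply/andP; split.
  by rewrite divr_ge0 // ltW.
have -> : 2 * m = (vol E [set: V])%:R / (w * n) by rewrite volT mulrA.
by rewrite ler_wpM2r ?ler_nat // invr_ge0 ltW.
Qed.

(** * Comparing the maximum with its limit *)

Lemma energy_perm (R : pzRingType) (I : finType) (x : I -> I -> R)
    (s : {perm I}) : energy (fun i => x (s i)) = energy x.
Proof.
rewrite /energy; congr (_ * _ - _);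
  by rewrite [RHS](reindex_inj (@perm_inj _ s)).
Qed.

Lemma kpart_perm (V : finType) (k : nat) (A : 'I_k -> {set V}) (s : 'S_k) :
  kpart_partition A -> kpart_partition (fun i => A (s i)).
Proof.
move=> hA v; have [i [vi ui]] := hA v.
exists (s^-1%g i); split; first by rewrite permKV.
by move=> j /ui ->; rewrite permK.
Qed.

Lemma balanced_near (R : realType) (V : finType) (k : nat)
    (P : 'I_k -> {set V}) (i : 'I_k) :
  (0 < k)%N -> (0 < #|V|)%N -> balanced P ->
  `|#|P i|%:R / #|V|%:R - k%:R^-1| <= #|V|%:R^-1 :> R.
Proof.
move=> k0 V0 /(_ i)/andP[lo hi].
have hlo : (#|V| <= k * #|P i| + k)%N.
  rewrite [leqLHS](divn_eq _ k) mulnC leq_add ?leq_mul2l ?lo ?orbT //.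
  by rewrite ltnW // ltn_pmod.
have hhi : (k * #|P i| <= #|V| + k)%N.
  rewrite mulnC -leq_divRL //; apply: leq_trans hi _.
  by rewrite leq_div2r // leq_add2l leq_pred.
move: hlo hhi; rewrite -!(ler_nat R) !natrD !natrM.
have kR : 0 < k%:R :> R by rewrite ltr0n.
have nR : 0 < #|V|%:R :> R by rewrite ltr0n.
move=> hlo hhi.
have -> : #|P i|%:R / #|V|%:R - k%:R^-1
    = (k%:R * #|P i|%:R - #|V|%:R) / (k%:R * #|V|%:R) :> R.
  by field; rewrite !gt_eqF.
have -> : #|V|%:R^-1 = k%:R / (k%:R * #|V|%:R) :> R.
  by field; rewrite !gt_eqF.
rewrite normrM normfV (gtr0_norm (mulr_gt0 kR nR)).
by rewrite ler_wpM2r ?invr_ge0 ?mulr_ge0 ?(ltW kR) ?(ltW nR) // ler_norml; lra.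
Qed.

Lemma kdist_itv (R : realType) (V : finType) (k : nat) (A P : 'I_k -> {set V}) :
  (0 < #|V|)%N -> kpart_partition P -> 0 <= kdist R A P <= 1.
Proof.
move=> V0 hP; have [s ->] := kdistP R A P.
have nR : 0 < #|V|%:R :> R by rewrite ltr0n.
set S := (\sum_(i < k) _)%N.
have SV : (S <= #|V|)%N.
  rewrite -(kpart_card hP); apply: leq_sum => i _.
  by rewrite subset_leq_card // subsetIr.
have h0 : 0 <= #|V|%:R^-1 * S%:R :> R by rewrite mulr_ge0 // invr_ge0 ltW.
have h1 : #|V|%:R^-1 * S%:R <= 1 :> R.
  by rewrite mulrC ler_pdivrMr // mul1r ler_nat.
by apply/andP; split; lra.
Qed.

Lemma sum_overlaps (R : realType) (V : finType) (k : nat)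
    (A P : 'I_k -> {set V}) (j : 'I_k) :
  kpart_partition A -> \sum_i overlaps R A P i j = #|P j|%:R / #|V|%:R.
Proof.
move=> hA; rewrite -mulr_suml -natr_sum -(kpart_sum (P j) hA).
by under [in RHS]eq_bigr => i _ do rewrite setIC.
Qed.

Lemma sum_parts (R : realType) (V : finType) (k : nat) (P : 'I_k -> {set V}) :
  (0 < #|V|)%N -> kpart_partition P ->
  \sum_j (#|P j|%:R / #|V|%:R) = 1 :> R.
Proof.
move=> V0 hP; rewrite -mulr_suml -natr_sum (kpart_card hP).
by rewrite divff // pnatr_eq0 -lt0n.
Qed.

(** [energy_le] applies once the parts are relabelled by a permutation that
    attains the distance, so that the diagonal sum is [1 - kdist R A P]. *)
Lemma energy_overlaps_le (R : realType) (V : finType) (k : nat)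
    (A P : 'I_k -> {set V}) :
  (2 <= k)%N -> (k <= #|V|)%N ->
  kpart_partition A -> kpart_partition P -> balanced P ->
  energy (overlaps R A P) <= hfun k (kdist R A P) + 3 * k%:R / #|V|%:R.
Proof.
move=> k2 kV hA hP bP.
have V0 : (0 < #|V|)%N by apply: leq_trans kV; exact: ltnW.
have /andP[D0 D1] := kdist_itv R A V0 hP.
have [s sE] := kdistP R A P.
have hAs := kpart_perm s hA.
pose x := overlaps R (fun i => A (s i)) P.
have -> : energy (overlaps R A P) = energy x by rewrite -(energy_perm _ s).
have DE : kdist R A P = 1 - \sum_i x i i.
  by rewrite sE /x -mulr_suml natr_sum mulrC.
have nR : 0 < #|V|%:R :> R by rewrite ltr0n.
have c1 : \sum_j \sum_i x i j = 1.
  by rewrite -(sum_parts R V0 hP); apply: eq_bigr => j _; exact: sum_overlaps.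
have x0 i j : 0 <= x i j by rewrite divr_ge0.
have ct j : `|\sum_i x i j - #|'I_k|%:R^-1| <= #|V|%:R^-1.
  by rewrite sum_overlaps // card_ord balanced_near // ltnW.
have I2 : (2 <= #|'I_k|)%N by rewrite card_ord.
have := energy_le I2 x0 c1 ct; cbv zeta; rewrite card_ord -DE.
move=> /le_trans; apply; rewrite /hfun -!addrA lerD2l lerD2l.
set D := kdist R A P in D0 D1 *; set n : R := #|V|%:R in nR *.
have kR : 2 <= k%:R :> R by rewrite (ler_nat R 2).
have kn : k%:R <= n by rewrite ler_nat.
have n10 : 0 <= n^-1 by rewrite invr_ge0 ltW.
have h1 : 2 * k%:R * D * n^-1 <= 2 * k%:R * n^-1.
  by rewrite ler_wpM2r // ler_piMr //; lra.
have h2 : k%:R * (k%:R - 1) * n^-1 ^+ 2 <= k%:R * n^-1.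
  have -> : k%:R * (k%:R - 1) * n^-1 ^+ 2 = k%:R * n^-1 * ((k%:R - 1) / n).
    by ring.
  have kn0 : 0 <= k%:R * n^-1 by rewrite mulr_ge0 //; lra.
  by rewrite ler_piMr // ler_pdivrMr // mul1r; lra.
lra.
Qed.

Lemma energy_relocate_ge (R : realType) (V : finType) (k : nat)
    (P : 'I_k -> {set V}) (T : {set V}) (i0 i1 : 'I_k) :
  (2 <= k)%N -> (k <= #|V|)%N -> kpart_partition P -> balanced P ->
  i0 != i1 -> T \subset P i0 ->
  let D := #|T|%:R / #|V|%:R in
  hfun k D - 3 * k%:R / #|V|%:R <= energy (overlaps R (relocate P T i1) P).
Proof.
move=> k2 kV hP bP i01 TP; cbv zeta; set n : R := #|V|%:R; set D := _ / n.
have V0 : (0 < #|V|)%N by apply: leq_trans kV; exact: ltnW.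
have nR : 0 < n by rewrite ltr0n.
have D0 : 0 <= D by rewrite divr_ge0 // ltW.
have D1 : D <= 1 by rewrite ler_pdivrMr // mul1r ler_nat max_card.
have ct (j : 'I_k) : `|#|P j|%:R / n - #|'I_k|%:R^-1| <= n^-1.
  by rewrite card_ord balanced_near // ltnW.
have xE i j : overlaps R (relocate P T i1) P i j
    = (i == j)%:R * (#|P j|%:R / n)
      + D * (((i == i1) && (j == i0))%:R - ((i == i0) && (j == i0))%:R).
  have := congr1 (fun m : nat => m%:R : R) (card_relocateI i1 i j hP TP).
  rewrite !natrD !natrM /overlaps -/n => h.
  have -> : #|relocate P T i1 i :&: P j|%:R
      = (i == j)%:R * #|P j|%:R + #|T|%:R * ((i == i1) && (j == i0))%:R
        - #|T|%:R * ((i == i0) && (j == i0))%:R :> R by rewrite -h addrK.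
  by rewrite /D; ring.
have := energy_move_ge i01 (sum_parts R V0 hP) ct D0 xE.
cbv zeta; rewrite card_ord; apply: le_trans.
rewrite /hfun lerD2l lerN2.
have kR : 2 <= k%:R :> R by rewrite (ler_nat R 2).
have n10 : 0 <= n^-1 by rewrite invr_ge0 ltW.
have : 2 * k%:R * D * n^-1 <= 2 * k%:R * n^-1.
  by rewrite ler_wpM2r // ler_piMr //; lra.
have : 0 <= k%:R * n^-1 by rewrite mulr_ge0 //; lra.
lra.
Qed.

Lemma hfun_close (R : realType) (k : nat) (d D r : R) :
  (1 <= k)%N -> 0 <= d <= 1 -> 0 <= D <= 1 -> `|D - d| <= r ->
  `|hfun k D - hfun k d| <= 4 * k%:R * r.
Proof.
move=> k1 hd hD hr.
have kR : 1 <= k%:R :> R by rewrite (ler_nat R 1).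
have -> : hfun k D - hfun k d = (D - d) * (2 * ((k%:R - 1) * (D + d) - 1)).
  by rewrite /hfun; ring.
have -> : 4 * k%:R * r = r * (4 * k%:R) by ring.
rewrite normrM ler_pM // ler_norml.
have h1 : 0 <= (k%:R - 1) * (D + d) by rewrite mulr_ge0; lra.
have h2 : (k%:R - 1) * (D + d) <= (k%:R - 1) * 2 by rewrite ler_wpM2l; lra.
by apply/andP; split; lra.
Qed.

Lemma exists_subset_card (V : finType) (A : {set V}) (t : nat) :
  (t <= #|A|)%N -> exists2 T : {set V}, T \subset A & #|T| = t.
Proof.
rewrite -bin_gt0 -cards_draws => /card_gt0P[T].
by rewrite inE => /andP[TA /eqP Tt]; exists T.
Qed.

(** As [d <= k%:R^-1], the integer part of [d * #|V|] is at most [#|V| %/ k],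
    hence at most the size of every planted part. *)
Lemma exists_relocation (R : realType) (V : finType) (k : nat)
    (P : 'I_k -> {set V}) (i0 i1 : 'I_k) (d : R) :
  (0 < #|V|)%N -> kpart_partition P -> balanced P -> i0 != i1 ->
  0 <= d <= k%:R^-1 ->
  exists T : {set V},
    [/\ T \subset P i0, kdist R (relocate P T i1) P = #|T|%:R / #|V|%:R
      & `|#|T|%:R / #|V|%:R - d| <= #|V|%:R^-1].
Proof.
move=> V0 hP bP i01 /andP[d0 dk].
have k0 : (0 < k)%N by apply: leq_ltn_trans (ltn_ord i0).
have kR : 0 < k%:R :> R by rewrite ltr0n.
have nR : 0 < #|V|%:R :> R by rewrite ltr0n.
have dn0 : 0 <= d * #|V|%:R by rewrite mulr_ge0 // ltW.
have /andP[t0 t1] := truncn_itv dn0.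
set t := Num.truncn _ in t0 t1.
have tP i : (t <= #|P i|)%N.
  have /andP[lo _] := bP i; apply: leq_trans lo; rewrite leq_divRL //.
  rewrite -(ler_nat R) natrM -ler_pdivlMr //; apply: le_trans t0 _.
  by rewrite mulrC ler_wpM2l // ltW.
have [T TP Tt] := exists_subset_card (tP i0).
exists T; split=> //.
  by apply: (@kdist_relocate _ _ _ _ _ i0) => // i; rewrite Tt.
have -> : #|T|%:R / #|V|%:R - d = (t%:R - d * #|V|%:R) / #|V|%:R.
  by rewrite Tt; field; rewrite gt_eqF.
rewrite normrM normfV (gtr0_norm nR) ler_piMl ?invr_ge0 ?(ltW nR) //.
by move: t1; rewrite -natr1 ler_norml => t1; apply/andP; split; lra.
Qed.

(** The window around [d] costs [(#|V|)^(-1/2)] because [hfun k] is Lipschitz;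
    this absorbs the rounding errors, of order [#|V|^-1]. *)
Lemma max_modularity_near (R : realType) (V : finType) (k : nat)
    (E : {set {set V}}) (P : 'I_k -> {set V}) (kappa K d : R) :
  (2 <= k)%N -> (k <= #|V|)%N -> kpart_partition P -> balanced P ->
  0 <= kappa <= 1 ->
  (forall AA, partition AA [set: V] -> (#|AA| <= k)%N ->
    `|modularity R E AA - kappa * energy (overlaps R (padded AA) P)| <= K) ->
  0 <= d <= k%:R^-1 ->
  exists2 H : R, is_max (modularities_near E P d) H &
    `|H - kappa * hfun k d| <= K + 7 * k%:R * (Num.sqrt #|V|%:R)^-1.
Proof.
move=> k2 kV hP bP /andP[ka0 ka1] hmod hd; have /andP[d0 dk] := hd.
have V0 : (0 < #|V|)%N by apply: leq_trans kV; exact: ltnW.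
have k0 : (0 < k)%N by exact: ltnW.
have kR : 2 <= k%:R :> R by rewrite (ler_nat R 2).
set r := (Num.sqrt _)^-1; have r0 : 0 <= r by rewrite invr_ge0 sqrtr_ge0.
have nr : #|V|%:R^-1 <= r.
  have nE : #|V|%:R = Num.sqrt #|V|%:R ^+ 2 :> R by rewrite sqr_sqrtr.
  have s1 : 1 <= Num.sqrt #|V|%:R :> R.
    by rewrite -[leLHS]sqrtr1 ler_sqrt ?ltr0n // (ler_nat R 1).
  rewrite [in leLHS]nE -exprVn expr2 -/r ler_piMr //.
  by rewrite invf_le1 // (lt_le_trans ltr01).
have d1 : d <= 1 by apply: le_trans dk _; rewrite invf_le1; lra.
have d01 : 0 <= d <= 1 by rewrite d0.
have knr : 3 * k%:R / #|V|%:R <= 3 * k%:R * r by rewrite ler_wpM2l //; lra.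
have scale (y z : R) : y <= z + 7 * k%:R * r ->
    kappa * y <= kappa * z + 7 * k%:R * r.
  move=> yz; apply: le_trans (ler_wpM2l ka0 yz) _.
  rewrite mulrDr lerD2l ler_piMl // !mulr_ge0 //; lra.
pose S (AA : {set {set V}}) := [&& partition AA [set: V], (#|AA| <= k)%N
  & d - r <= kdist R (padded AA) P <= d + r].
have upper AA : S AA ->
    modularity R E AA <= kappa * hfun k d + (K + 7 * k%:R * r).
  move=> /and3P[pAA AAk dAA]; set D := kdist R (padded AA) P in dAA.
  have hA := padded_kpart pAA AAk.
  have := energy_overlaps_le R k2 kV hA hP bP; rewrite -/D => eD.
  have Dd : `|D - d| <= r by rewrite ler_norml; case/andP: dAA; lra.
  have := hfun_close k0 d01 (kdist_itv R (padded AA) V0 hP) Dd.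
  rewrite ler_norml => /andP[_ hDd].
  have eDd : energy (overlaps R (padded AA) P) <= hfun k d + 7 * k%:R * r.
    by rewrite -/D in hDd; lra.
  have := scale _ _ eDd; have := hmod AA pAA AAk.
  by rewrite ler_norml => /andP[_]; lra.
pose i0 : 'I_k := Ordinal k0; pose i1 : 'I_k := Ordinal k2.
have i01 : i0 != i1 by [].
have [T [TP dT Td]] := exists_relocation V0 hP bP i01 hd.
have hB := relocate_kpart T i1 hP.
have [pA0 A0k] := nonempty_partsP hB.
have [s padB] := padded_nonempty_parts hB.
set A0 := nonempty_parts _ in pA0 A0k padB.
have dA0 : kdist R (padded A0) P = #|T|%:R / #|V|%:R.
  by rewrite (kdist_perm _ _ padB).
have {}Td := le_trans Td nr.
have SA0 : S A0.
  rewrite /S pA0 A0k dA0 /=; move: Td; rewrite ler_norml => /andP[].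
  by move=> *; apply/andP; split; lra.
have lower : kappa * hfun k d <= modularity R E A0 + (K + 7 * k%:R * r).
  have eE : energy (overlaps R (padded A0) P)
      = energy (overlaps R (relocate P T i1) P).
    rewrite -[RHS](energy_perm _ s); congr energy.
    by apply/funext => i; apply/funext => j; rewrite /overlaps padB.
  have := energy_relocate_ge R k2 kV hP bP i01 TP; cbv zeta; rewrite -eE => eD.
  have D01 : 0 <= (#|T|%:R / #|V|%:R : R) <= 1 by rewrite -dT kdist_itv.
  have := hfun_close k0 d01 D01 Td; rewrite ler_norml => /andP[hDd _].
  have eDd : hfun k d <= energy (overlaps R (padded A0) P) + 7 * k%:R * r.
    lra.
  have := scale _ _ eDd; have := hmod A0 pA0 A0k.
  by rewrite ler_norml => /andP[]; lra.
case: (Order.TotalTheory.arg_maxP (modularity R E) SA0) => AA SAA maxAA.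
exists (modularity R E AA).
  split; first by have /and3P[? ? ?] := SAA; exists AA.
  move=> _ [BB [pBB BBk dBB ->]]; apply: maxAA.
  by rewrite /S pBB BBk dBB.
have := upper AA SAA; have := maxAA A0 SA0 => /= m0 m1.
by rewrite ler_norml; apply/andP; split; lra.
Qed.

Theorem theorem2p6 (R : realType) (a b : R) (k : nat)
    (hb : 0 < b) (hab : b < a) (hk : (2 <= k)%N) (eps : R) (heps : 0 < eps) :
  exists c : R,
  forall omega : nat -> R,
  exists N : nat,
  forall n : nat, (N <= n)%N ->
  let p := omega n * a / n%:R in
  let q := omega n * b / n%:R in
  c < omega n -> 0 <= p <= 1 -> 0 <= q <= 1 ->
  forall P : 'I_k -> {set 'I_n},
  kpart_partition P -> balanced P ->
  1 - eps <=
    sbm_prob p q P (fun E =>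
      forall d : R, 0 <= d <= k%:R^-1 ->
      exists2 H : R, is_max (modularities_near E P d) H &
        `|H - (a - b) / (a + (k%:R - 1) * b) * hfun k d| <= eps).
Proof.
have kR : 2 <= k%:R :> R by rewrite (ler_nat R 2).
have kb : 0 <= (k%:R - 1) * b by rewrite mulr_ge0 //; lra.
pose F0 : R := (a + (k%:R - 1) * b) / (2 * k%:R).
have F00 : 0 < F0 by rewrite divr_gt0 //; lra.
pose C : R := k%:R * (18 + 4 * k%:R).
have C0 : 0 < C by rewrite mulr_gt0 //; lra.
(* Half of [eps] pays for the fluctuations of the edge counts, and the other
   half for the window around [d] and the roundings. *)
pose t : R := Num.min (F0 / 4) (eps * F0 / (2 * C)).
have t0 : 0 < t.
  by rewrite lt_min; apply/andP; split; apply: divr_gt0 => //; apply: mulr_gt0.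
have tF : t <= F0 / 4 by rewrite ge_min lexx.
have tC : C * t / F0 <= eps / 2.
  have : t <= eps * F0 / (2 * C) by rewrite ge_min lexx orbT.
  move=> /(ler_wpM2l (ltW C0)) h; rewrite ler_pdivrMr //.
  apply: le_trans h _.
  by rewrite le_eqVlt; apply/orP; left; apply/eqP; field; lra.
have [c c0 conc] := sbm_edges_concentrate hb hab t0 heps.
exists c => omega.
pose M1 : R := a / t; pose M2 : R := (14 * k%:R / eps) ^+ 2.
have M10 : 0 <= M1 by rewrite divr_ge0 //; lra.
have M20 : 0 <= M2 by exact: sqr_ge0.
exists (k + Num.bound M1 + Num.bound M2)%N => n Nn p q cw hp hq P hP bP.
have kn : (k <= n)%N by apply: leq_trans Nn; rewrite -addnA leq_addr.
have V0 : (0 < n)%N by apply: leq_trans kn; exact: ltnW.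
have nM1 : M1 <= n%:R.
  apply: le_trans (ltW (archi_boundP M10)) _; rewrite ler_nat.
  by apply: leq_trans Nn; rewrite addnAC leq_addl.
have nM2 : M2 <= n%:R.
  apply: le_trans (ltW (archi_boundP M20)) _; rewrite ler_nat.
  by apply: leq_trans Nn; rewrite leq_addl.
have n0 : 0 < n%:R :> R by rewrite ltr0n.
have w0 : 0 < omega n by exact: le_lt_trans c0 cw.
have conc_n := conc 'I_n k P (omega n).
rewrite card_ord in conc_n; apply: conc_n => //.
move=> E sE hE d hd.
have cV : (k <= #|'I_n|)%N by rewrite card_ord.
have kappa01 : 0 <= (a - b) / (a + (k%:R - 1) * b) <= 1.
  rewrite ler_pdivrMr ?mul1r; last by lra.
  by apply/andP; split; [rewrite divr_ge0|]; lra.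
have pi_near j : `|#|P j|%:R / #|'I_n|%:R - k%:R^-1| <= #|'I_n|%:R^-1 :> R.
  by apply: balanced_near; rewrite ?card_ord // ltnW.
have at_n : a / n%:R <= t by move: nM1; rewrite !ler_pdivrMr // mulrC.
have mod_near AA : partition AA [set: 'I_n] -> (#|AA| <= k)%N ->
    `|modularity R E AA - (a - b) / (a + (k%:R - 1) * b)
        * energy (overlaps R (padded AA) P)| <= C * t / F0.
  move=> pAA AAk.
  apply: (@modularity_near_energy R _ k a b (omega n) t E P AA);
    rewrite ?card_ord // => j.
  by have := pi_near j; rewrite card_ord.
have [H maxH nearH] := max_modularity_near hk cV hP bP kappa01 mod_near hd.
exists H => //; apply: le_trans nearH _; rewrite card_ord.
have sn : 14 * k%:R / eps <= Num.sqrt n%:R.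
  have e0 : 0 <= 14 * k%:R / eps by rewrite divr_ge0 //; lra.
  by rewrite -(ger0_norm e0) -sqrtr_sqr ler_sqrt.
have s0 : 0 < Num.sqrt n%:R :> R by rewrite sqrtr_gt0.
have : 7 * k%:R * (Num.sqrt n%:R)^-1 <= eps / 2.
  rewrite ler_pdivrMr //; move: sn; rewrite ler_pdivrMr //; lra.
by lra.
Qed.
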